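(* Let $K$ be an algebraically closed field of characteristic zero, let $\mathfrak{g}$ be an $n$-dimensional filiform nilpotent Lie algebra over $K$, and assume that there exists an affine cohomology class $[\omega]\in H^2(\mathfrak{g},K)$. Then $\mathfrak{g}$ admits an affine structure.
   Context: Lower central series: $\mathfrak{g}^0=\mathfrak{g}$, $\mathfrak{g}^k=[\mathfrak{g}^{k-1},\mathfrak{g}]$ for $k\ge 1$. A nilpotent Lie algebra $\mathfrak{g}$ of dimension $n$ is called filiform if $\mathfrak{g}^{n-1}=0$ and $\mathfrak{g}^{n-2}\neq 0$. $\mathfrak{z}(\mathfrak{g})$ denotes the center. $H^2(\mathfrak{g},K)=Z^2(\mathfrak{g},K)/B^2(\mathfrak{g},K)$ is Lie algebra cohomology with coefficients in the trivial one-dimensional module $K$. A $2$-cocycle $\omega\in Z^2(\mathfrak{g},K)$, $\omega:\mathfrak{g}\wedge\mathfrak{g}\to K$, is called affine if it is nonzero on $\mathfrak{z}(\mathfrak{g})\wedge\mathfrak{g}$. A class $[\omega]\in H^2(\mathfrak{g},K)$ is called affine if every representative of it is affine. An affine structure on a Lie algebra $\mathfrak{g}$ is a $K$-bilinear product $\mathfrak{g}\times\mathfrak{g}\to\mathfrak{g}$, $(x,y)\mapsto x\cdot y$, satisfying for all $x,y,z\in\mathfrak{g}$: $x\cdot(y\cdot z)-(x\cdot y)\cdot z=y\cdot(x\cdot z)-(y\cdot x)\cdot z$ and $[x,y]=x\cdot y-y\cdot x$. *)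

(* Defs.v *)
From HB Require Import structures.
From mathcomp Require Import all_boot all_algebra.

Set Implicit Arguments.
Unset Strict Implicit.
Unset Printing Implicit Defensive.

Import GRing.Theory.
Local Open Scope ring_scope.

HB.mixin Record Vector_isLieAlgebra (K : fieldType) L of Vector K L := {
  lie : {bilinear L -> L -> L};
  liexx : forall x : L, lie x x = 0;
  lie_jacobi : forall x y z : L,
    lie x (lie y z) + lie y (lie z x) + lie z (lie x y) = 0
}.

#[short(type="lieAlgType")]
HB.structure Definition LieAlgebra (K : fieldType) :=
  {L of Vector K L & Vector_isLieAlgebra K L}.


Section LowerCentralSeries.
Variables (K : fieldType) (g : lieAlgType K).
Implicit Types U V W : {vspace g}.

(* The span of the brackets of U with V, given as in prodv by the brackets of
   basis vectors; see lieprodvP. *)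
Definition lieprodv U V : {vspace g} :=
  <<[seq lie u v | u <- vbasis U, v <- vbasis V]>>%VS.

Lemma memv_lie U V u v : u \in U -> v \in V -> lie u v \in lieprodv U V.
Proof.
move=> /coord_vbasis -> /coord_vbasis ->.
rewrite linear_sumr rpred_sum // => j _; rewrite linearZr_LR rpredZ //.
rewrite linear_sumlz rpred_sum // => i _.
rewrite linearZl_LR rpredZ // memv_span //.
by apply: allpairs_f; rewrite mem_nth // size_tuple.
Qed.

Lemma lieprodvP {U V W} :
  reflect (forall u v, u \in U -> v \in V -> lie u v \in W)
          (lieprodv U V <= W)%VS.
Proof.
apply: (iffP idP) => [sUVW u v Uu Vv|sUVW].
  exact: (subvP sUVW) (memv_lie Uu Vv).
apply/span_subvP => _ /allpairsP[[u v] /= [Uu Vv ->]].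
by apply: sUVW; apply: vbasis_mem.
Qed.

Fixpoint lower_central (k : nat) : {vspace g} :=
  if k is k'.+1 then lieprodv (lower_central k') fullv else fullv.

End LowerCentralSeries.

Definition lie_nilpotent (K : fieldType) (g : lieAlgType K) : Prop :=
  exists k, lower_central g k = 0%VS.

(* The truncation of the subtractions is harmless: in dimension 0 or 1 the last
   two conditions contradict each other, so a filiform algebra has dimension at
   least 2. *)
Definition filiform (K : fieldType) (g : lieAlgType K) : Prop :=
  let n := \dim {:g} in
  [/\ lie_nilpotent g,
      lower_central g (n - 1) = 0%VS
    & lower_central g (n - 2) <> 0%VS].

Definition in_lie_center (K : fieldType) (g : lieAlgType K) (z : g) : Prop :=
  forall x : g, lie z x = 0.

Section SecondCohomology.
Variables (K : fieldType) (g : lieAlgType K).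
Implicit Types w : {biscalar g}.

Definition cocycle2 w : Prop :=
  (forall x, w x x = 0) /\
  (forall x y z, w (lie x y) z + w (lie y z) x + w (lie z x) y = 0).

(* The sign convention for the differential of a 1-cochain does not affect
   the space B^2. *)
Definition coboundary2 (b : g -> g -> K) : Prop :=
  exists f : {scalar g}, forall x y, b x y = f (lie x y).

(* Z^2(g, K) / B^2(g, K), its elements being the cosets of B^2 in Z^2, that is
   the sets of all their representatives. *)
Record H2 := MkH2 {
  represents :> {biscalar g} -> Prop;
  _ : exists2 w, cocycle2 w
      & forall w', represents w' <->
          cocycle2 w' /\ coboundary2 (fun x y => w' x y - w x y)
}.

Definition H2_class w (Zw : cocycle2 w) : H2 :=
  @MkH2 (fun w' => cocycle2 w' /\ coboundary2 (fun x y => w' x y - w x y))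
        (ex_intro2 _ _ w Zw (fun w' => iff_refl _)).

Lemma H2_class_represents w (Zw : cocycle2 w) : H2_class Zw w.
Proof.
split=> //; exists (\0 : {scalar g}) => x y; exact: subrr.
Qed.

Definition affine_cocycle w : Prop :=
  cocycle2 w /\ exists z x : g, in_lie_center z /\ w z x <> 0.

Definition affine_class (c : H2) : Prop := forall w, c w -> affine_cocycle w.

End SecondCohomology.

Definition is_affine_structure (K : fieldType) (g : lieAlgType K)
    (m : {bilinear g -> g -> g}) : Prop :=
  (forall x y z, m x (m y z) - m (m x y) z = m y (m x z) - m (m y x) z) /\
  (forall x y, lie x y = m x y - m y x).

Definition admits_affine_structure (K : fieldType) (g : lieAlgType K) : Prop :=
  exists m : {bilinear g -> g -> g}, is_affine_structure m.

(* Main.v *)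
(* Let w be an affine cocycle and h = g + K the central extension of g by w. As
   the centre of g is the last nonzero term of the lower central series, h is
   filiform too; hence for e outside finitely many proper subspaces, the map
   D : x |-> [e, x]_h from g to h has kernel Ke and image [h, h]. Since g acts
   on h and D is a 1-cocycle, inverting D up to a projection of g along e that
   fixes [g, g] turns the action of g on [h, h] into the affine structure
   x . y = D^-1 [x, D y]_h. *)
Require Import Defs.
From HB Require Import structures.
From mathcomp Require Import all_boot all_algebra zify.
Set Implicit Arguments.
Unset Strict Implicit.
Unset Printing Implicit Defensive.

Import GRing.Theory.
Local Open Scope ring_scope.

(** * Avoiding finitely many proper subspaces *)

Section VectorSpaces.
Variables (K : fieldType) (V : vectType K).
Implicit Types (U W : {vspace V}) (Us : seq {vspace V}).

Lemma ltn_dim_addv_line U v : v \notin U -> (\dim U < \dim (<[v]> + U))%N.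
Proof.
rewrite ltnNge; apply: contra => dimle.
have /eqP-> : (U == <[v]> + U)%VS by rewrite eqEdim addvSr.
by rewrite memvE addvSl.
Qed.

Lemma codim1_addv_line U W v :
    (U <= W)%VS -> (\dim W <= (\dim U).+1)%N -> v \in W -> v \notin U ->
  W = (<[v]> + U)%VS.
Proof.
move=> sUW dimW Wv U'v; apply/esym/eqP; rewrite eqEdim subv_add sUW -memvE Wv /=.
exact: leq_trans dimW (ltn_dim_addv_line U'v).
Qed.

(** Two points of the line in [U] would differ by a nonzero multiple of [e]. If the line misses [U],
    the value [b = 0] is arbitrary. *)
Lemma line_meets_subspace_once U e y :
  e \notin U -> exists b, forall t, y + t *: e \in U -> t = b.
Proof.
move=> U'e; have [|/memv_addP y'] := boolP (y \in U + <[e]>)%VS.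
  case/memv_addP=> u Uu [_ /vlineP[k ->] ->]; exists (- k) => t.
  rewrite -addrA -scalerDl rpredDl // => Ute; apply/eqP; rewrite -addr_eq0 addrC.
  by apply: contraR U'e => nz; move: Ute; rewrite rpredZeq (negPf nz).
exists 0 => t Ut; case: y'; exists (y + t *: e) => //.
exists (- t *: e); first by rewrite rpredZ // memv_line.
by rewrite -addrA -scalerDl subrr scale0r addr0.
Qed.

End VectorSpaces.

(** Induction: if [e] avoids [Us] but lies in [U], take [y] outside [U]. The line [y + t *: e]
    misses [U], each member of [Us] excludes at most one [t], and a closed field is infinite. *)
Lemma avoid_subspaces (K : closedFieldType) (V : vectType K)
    (Us : seq {vspace V}) :
    (forall U, U \in Us -> exists v, v \notin U) ->
  exists v, forall U, U \in Us -> v \notin U.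
Proof.
elim: Us => [|U Us IH] proper; first by exists 0.
have [|e eP] := IH; first by move=> W UsW; apply: proper; rewrite inE UsW orbT.
have [Ue|U'e] := boolP (e \in U); last first.
  by exists e => W /predU1P[->|/eP].
have [y U'y] := proper U (mem_head _ _).
have [bad badP]: exists bad : seq K, forall t, t \notin bad ->
    forall W, W \in Us -> y + t *: e \notin W.
  elim: (Us) eP => [|W Ws IHW] eP; first by exists nil.
  have [|bad badP] := IHW; first by move=> X X_; apply: eP; rewrite inE X_ orbT.
  have [b bP] := line_meets_subspace_once y (eP W (mem_head _ _)).
  exists (b :: bad) => t; rewrite inE negb_or => /andP[tb tbad] X.
  by case/predU1P=> [->|/badP->//]; apply: contra tb => /bP->.
have nz : \prod_(b <- bad) ('X - b%:P) != 0 :> {poly K}.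
  by rewrite monic_neq0 ?monic_prod_XsubC.
have [t] := closed_nonrootP _ nz; rewrite root_prod_XsubC => tbad.
exists (y + t *: e) => W /predU1P[->|]; last exact: badP.
by rewrite rpredDr ?rpredZ.
Qed.

Arguments lower_central : simpl never.

(** * Lower central series and nilpotency *)

Section LowerCentral.
Variables (K : fieldType) (g : lieAlgType K).
Implicit Types (x y z : g) (U V : {vspace g}).
Local Notation lcs := (lower_central g).

Lemma lieC x y : lie x y = - lie y x.
Proof.
apply/eqP; rewrite -addr_eq0; have := liexx (x + y).
by rewrite linearDl !linearDr /= !liexx add0r addr0 addrC => ->.
Qed.

Lemma lieprodvS U U' V V' :
  (U <= U')%VS -> (V <= V')%VS -> (lieprodv U V <= lieprodv U' V')%VS.
Proof.
move=> sU sV; apply/lieprodvP => u v /(subvP sU) Uu /(subvP sV) Vv.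
exact: memv_lie.
Qed.

Lemma lcs_sub k : (lcs k.+1 <= lcs k)%VS.
Proof. by elim: k => [|k IH]; rewrite ?subvf //; apply: lieprodvS. Qed.

Lemma lcs_leq {j k} : (j <= k)%N -> (lcs k <= lcs j)%VS.
Proof.
by move/subnK<-; elim: (k - j)%N => // i; apply: subv_trans; apply: lcs_sub.
Qed.

Lemma memv_lcs k x y : x \in lcs k -> lie x y \in lcs k.+1.
Proof. by move=> xk; apply: memv_lie => //; apply: memvf. Qed.

Lemma memv_lcsr k x y : y \in lcs k -> lie x y \in lcs k.+1.
Proof. by move=> yk; rewrite lieC rpredN memv_lcs. Qed.

Hypothesis nil_g : lie_nilpotent g.

Lemma lcs_stable_eq0 k : (lcs k <= lcs k.+1)%VS -> lcs k = 0%VS.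
Proof.
case: nil_g => j lcsj0 stab; apply/eqP; rewrite -subv0 -lcsj0.
suff: (lcs k <= lcs (j + k))%VS.
  by move/subv_trans; apply; rewrite lcs_leq ?leq_addr.
elim: j {lcsj0} => [|j IH] //; apply: subv_trans stab _.
exact: lieprodvS.
Qed.

Lemma ltn_dim_lcs k : lcs k != 0%VS -> (\dim (lcs k.+1) < \dim (lcs k))%N.
Proof.
rewrite ltnNge; apply: contra => dimle; apply/eqP/lcs_stable_eq0.
suff /eqP->: lcs k.+1 == lcs k by [].
by rewrite eqEdim lcs_sub.
Qed.

(** Modulo [lcs 2], brackets of vectors of [U] span [lcs 1], so here the series stops dropping at
    [lcs 1]. *)
Lemma lcs1_eq0_gen U :
    (U + lcs 1)%VS = fullv ->
    (forall x y, x \in U -> y \in U -> lie x y \in lcs 2) ->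
  lcs 1 = 0%VS.
Proof.
move=> defg UU; apply: lcs_stable_eq0; apply/lieprodvP => x y.
rewrite -defg => /memv_addP[u Uu [x' x'1 ->]] /memv_addP[v Uv [y' y'1 ->]].
rewrite linearDl !linearDr /= !rpredD //.
- exact: UU.
- exact: memv_lcsr.
- exact: memv_lcs.
- exact: memv_lcs.
Qed.

(** Modulo [lcs k.+2], every bracket of [lcs k] with [g] is a multiple of a bracket with [v]. *)
Lemma lcs_eq0_gen k v :
    lcs k = (<[v]> + lcs k.+1)%VS -> (forall x, lie v x \in lcs k.+2) ->
  lcs k.+1 = 0%VS.
Proof.
move=> defk Pv; apply: lcs_stable_eq0.
apply/(lieprodvP (U := lcs k) (V := fullv)) => x y.
rewrite defk => /memv_addP[_ /vlineP[a ->] [x' x'1 ->]] _.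
rewrite linearDl linearZl_LR /= rpredD ?memv_lcs // rpredZ //.
Qed.

End LowerCentral.

(** * Filiform algebras: dimensions, centre and centralizers *)

Section Filiform.
Variables (K : fieldType) (g : lieAlgType K).
Hypothesis fil_g : filiform g.
Local Notation lcs := (lower_central g).
Local Notation n := (\dim {:g}).

Let nil_g : lie_nilpotent g. Proof. by case: fil_g. Qed.

Lemma filiform_dim_gt1 : (1 < n)%N.
Proof.
case: fil_g => _; case En: n => [|[|//]] /= top bot; last by case: bot.
by case: bot.
Qed.

Lemma filiform_lcs_neq0 k : (k <= n - 2)%N -> lcs k != 0%VS.
Proof.
move=> le_k; case: fil_g => _ _ bot; apply/eqP=> k0; apply: bot.
by apply/eqP; rewrite -subv0 -k0 lcs_leq.
Qed.

(** In codimension one, a single [y] would span [g] modulo [lcs 1], and [lie y y = 0] would force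
    [lcs 1 = 0]. *)
Lemma filiform_dim_lcs1 : (\dim (lcs 1) <= n - 2)%N.
Proof.
have [->|] := eqVneq (lcs 1) 0%VS; first by rewrite dimv0.
have n_gt1 := filiform_dim_gt1.
apply: contraNT; rewrite -ltnNge -subSn // subSS => dim1; apply/eqP.
have /subvPn[y _ y1]: ~~ (fullv <= lcs 1)%VS.
  have := ltn_dim_lcs nil_g (filiform_lcs_neq0 (leq0n _)).
  by rewrite ltnNge; apply: contra; apply: dimvS.
apply: (lcs1_eq0_gen nil_g (U := <[y]>)).
  apply/esym/codim1_addv_line; rewrite ?subvf ?memvf //.
  by rewrite subn1 in dim1; rewrite -(ltn_predK n_gt1).
move=> _ _ /vlineP[a ->] /vlineP[b ->].
by rewrite linearZl_LR linearZr_LR /= liexx !scaler0 mem0v.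
Qed.

(** The upper bound descends strictly from [lcs 1]; the lower bound climbs strictly from
    [lcs (n - 2)], which is nonzero. *)
Lemma filiform_dim_lcs k : (0 < k < n)%N -> \dim (lcs k) = (n - k.+1)%N.
Proof.
case/andP=> k_gt0 lt_kn; apply/eqP; rewrite eqn_leq; apply/andP; split.
  elim: k k_gt0 lt_kn => [//|[|k] IH] _ lt_kn; first exact: filiform_dim_lcs1.
  have := ltn_dim_lcs nil_g (filiform_lcs_neq0 (k := k.+1) ltac:(lia)).
  have := IH isT (ltnW lt_kn); lia.
have dim_ge d : (d <= n - 2 -> d < \dim (lcs (n - 2 - d)))%N.
  elim: d => [_|d IH lt_d].
    by rewrite subn0 lt0n dimv_eq0 filiform_lcs_neq0.
  have := ltn_dim_lcs nil_g (filiform_lcs_neq0 (k := n - 2 - d.+1) ltac:(lia)).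
  by apply: leq_ltn_trans; rewrite -subSn // subSS IH // ltnW.
have [lt_k|] := ltnP k (n - 1); last by lia.
by have := dim_ge (n - 2 - k)%N (leq_subr _ _); rewrite subKn; lia.
Qed.

Lemma filiform_lcsE k v :
    (0 < k < n - 1)%N -> v \in lcs k -> v \notin lcs k.+1 ->
  lcs k = (<[v]> + lcs k.+1)%VS.
Proof.
move=> lt_kn; apply: codim1_addv_line; first exact: lcs_sub.
by rewrite !filiform_dim_lcs; lia.
Qed.

(** As [v] spans [lcs k] modulo [lcs k.+1], the series would otherwise vanish already at
    [lcs k.+1]. *)
Lemma filiform_bracket k v :
    (0 < k < n - 2)%N -> v \in lcs k -> v \notin lcs k.+1 ->
  exists x, lie v x \notin lcs k.+2.
Proof.
move=> lt_kn kv k1v; have lk : lcs k.+1 != 0%VS.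
  by rewrite filiform_lcs_neq0 //; lia.
have /subvPn[x _ xP]: ~~ (fullv <= linfun (lie v) @^-1: lcs k.+2)%VS.
  apply: contra lk => /subvP lev; apply/eqP/(lcs_eq0_gen nil_g (v := v)).
    by apply: filiform_lcsE => //; lia.
  by move=> x; have := lev x (memvf x); rewrite -memv_preim lfunE.
by exists x; rewrite -memv_preim lfunE in xP.
Qed.

(** Otherwise the commuting vectors [x] and [e] span [g] modulo [lcs 1], which has codimension 2,
    and [lcs 1] vanishes. *)
Lemma filiform_bracket0 e x :
    (2 < n)%N -> e \notin lcs 1 -> lie e x = 0 -> x \in (<[e]> + lcs 1)%VS.
Proof.
move=> n_gt2 e1 ex; apply: contraT => xP.
suff lcs1_eq0: lcs 1 = 0%VS.
  by have := filiform_lcs_neq0 (k := 1) ltac:(lia); rewrite lcs1_eq0 eqxx.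
apply: (lcs1_eq0_gen nil_g (U := <[x]> + <[e]>)); last first.
  move=> y z /memv_addP[_ /vlineP[a ->] [_ /vlineP[b ->] ->]].
  move=> /memv_addP[_ /vlineP[c ->] [_ /vlineP[d ->] ->]].
  rewrite linearDl !linearDr !linearZl_LR !linearZr_LR /= !liexx (lieC x) ex.
  by rewrite oppr0 !scaler0 !addr0 mem0v.
rewrite -addvA; apply/esym/codim1_addv_line; rewrite ?subvf ?memvf //.
have := ltn_dim_addv_line e1; rewrite filiform_dim_lcs; lia.
Qed.

(** Outside [lcs 1], a central [z] would give [<[z]> + lcs 1 = g], against codimension 2. Inside,
    [filiform_bracket] pushes [z] down term by term. *)
Lemma filiform_center_sub z :
  (2 < n)%N -> in_lie_center z -> z \in lcs (n - 2).
Proof.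
move=> n_gt2 Zz; have z1: z \in lcs 1.
  apply: contraT => z1; have /subvPn[x _ /negP[]]: ~~ (fullv <= <[z]> + lcs 1)%VS.
    apply: contraL (n_gt2) => /dimvS.
    have := leq_of_leqif (dimv_add_leqif <[z]> (lcs 1)).
    by rewrite dim_vline filiform_dim_lcs; case: (z != 0); lia.
  by apply: filiform_bracket0.
suff zk k : (k < n - 2)%N -> z \in lcs k.+1.
  by have := zk (n - 3)%N ltac:(lia); rewrite -subSn.
elim: k => // k IH lt_k; have zk := IH (ltnW lt_k); apply: contraT => zk1.
have [x] := filiform_bracket (k := k.+1) ltac:(lia) zk zk1.
by rewrite Zz mem0v.
Qed.

(** The hypothesis on [e] makes ad [e] injective between successive one-dimensional quotients, so
    the part of [x] in [lcs 1] sinks to the last nonzero term. *)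
Lemma filiform_centralizer e x :
    (2 < n)%N -> e \notin lcs 1 ->
    (forall k, (0 < k < n - 2)%N ->
       exists2 v, v \in lcs k & lie v e \notin lcs k.+2) ->
  lie e x = 0 -> x \in (<[e]> + lcs (n - 2))%VS.
Proof.
move=> n_gt2 e1 eP ex.
have /memv_addP[_ /vlineP[c ->] [y y1 defx]] := filiform_bracket0 n_gt2 e1 ex.
rewrite defx memv_add ?memvZ ?memv_line //.
have ey: lie e y = 0.
  by move: ex; rewrite defx linearDr linearZr_LR /= liexx scaler0 add0r.
suff yk k : (k < n - 2)%N -> y \in lcs k.+1.
  by have := yk (n - 3)%N ltac:(lia); rewrite -subSn.
elim: k => // k IH lt_k; have:= IH (ltnW lt_k).
have [v vk ve] := eP k.+1 ltac:(lia).
have vk1: v \notin lcs k.+2 by apply: contra ve; apply: memv_lcs.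
rewrite (@filiform_lcsE k.+1 v) //; last by lia.
case/memv_addP=> [_ /vlineP[a ->] [u uk defy]].
rewrite defy rpredD //.
have: a *: lie v e \in lcs k.+3.
  have -> : a *: lie v e = - lie u e.
    apply/eqP; rewrite -addr_eq0 -linearZl_LR -linearDl /= -defy.
    by rewrite lieC ey oppr0.
  by rewrite rpredN memv_lcs.
by rewrite rpredZeq (negPf ve) orbF => /eqP->; rewrite scale0r mem0v.
Qed.

End Filiform.

(** * The affine structure built from a cocycle *)

Section AffineStructure.
Variables (K : fieldType) (g : lieAlgType K) (w : {biscalar g}).
Hypothesis Zw : cocycle2 w.
Implicit Types x y z : g.
Local Notation h := (g * K^o)%type.

(** The bracket of the central extension depends only on the components in [g], so [ext_lie x u.1]
    is the action of [x] on [u] in [h]. *)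
Definition ext_lie x y : h := (lie x y, w x y).

Fact ext_lie_is_linear x : linear (ext_lie x).
Proof. by move=> a y z; rewrite /ext_lie !linearDr !linearZr_LR. Qed.

HB.instance Definition _ x :=
  GRing.isLinear.Build K g h *:%R (ext_lie x) (ext_lie_is_linear x).

Lemma cocycle2C x y : w x y = - w y x.
Proof.
apply/eqP; rewrite -addr_eq0; have [ww _] := Zw; have := ww (x + y).
by rewrite linearDl !linearDr /= !ww add0r addr0 addrC => ->.
Qed.

Lemma ext_lieC x y : ext_lie x y = - ext_lie y x.
Proof. by rewrite /ext_lie lieC cocycle2C. Qed.

Lemma ext_lie_jacobi x y z :
  ext_lie (lie x y) z = ext_lie x (lie y z) - ext_lie y (lie x z).
Proof.
have [_ ww] := Zw; rewrite /ext_lie; congr (_, _) => /=; apply/eqP.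
  rewrite (lieC x z) linearNr opprK (lieC (lie x y)) eq_sym -subr_eq0 opprK.
  by rewrite lie_jacobi.
rewrite (cocycle2C x) (cocycle2C y) opprK (lieC x z) linearNl -opprD.
by rewrite -subr_eq0 opprK addrA ww.
Qed.

Variable e : g.
Hypotheses (dim_lcs1 : (\dim (lower_central g 1) + 2 <= \dim {:g})%N)
  (e_notin : e \notin lower_central g 1)
  (centr_e : forall x, ext_lie e x = 0 -> x \in <[e]>%VS).

Let D : 'Hom(g, h) := linfun (ext_lie e).

Let DE x : D x = ext_lie e x. Proof. exact: lfunE. Qed.

(** The preimage [F] of [lcs 1] in [h] contains [limg D] and has dimension at most [n - 1], with [n]
    the dimension of [g]; the kernel of [D] has dimension at most 1, so the two coincide. *)
Lemma ext_lie_memv_limg x y : ext_lie x y \in limg D.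
Proof.
pose p : 'Hom(h, g) := linfun fst.
have pE u : p u = u.1 by rewrite lfunE.
pose F := (p @^-1: lower_central g 1)%VS.
have memF u v : ext_lie u v \in F by rewrite -memv_preim pE memv_lcs ?memvf.
suff /eqP->: limg D == F by [].
rewrite eqEdim; apply/andP; split.
  by apply/subvP=> _ /memv_imgP[u _ ->]; rewrite DE.
have := limg_ker_dim D fullv; have := limg_ker_dim p fullv.
have := limg_ker_dim p F; rewrite !capfv.
have -> : limg p = fullv.
  apply/eqP; rewrite eqEsubv subvf; apply/subvP => u _.
  by have <-: p (u, 0) = u := pE _; apply: memv_img; apply: memvf.
have : (\dim (F :&: lker p) <= \dim (lker p))%N by rewrite dimvS ?capvSr.
have : (\dim (p @: F) <= \dim (lower_central g 1))%N.
  by apply: dimvS; apply/subvP=> _ /memv_imgP[u Fu ->]; rewrite memv_preim.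
have : (\dim (lker D) <= 1)%N.
  rewrite (leq_trans (n := \dim <[e]>)) ?dim_vline ?leq_b1 // -dim_vline dimvS //.
  by apply/subvP=> u; rewrite memv_ker DE => /eqP/centr_e.
have -> : \dim {: h} = (\dim {:g} + 1)%N by rewrite !dimvf.
by move: dim_lcs1; lia.
Qed.

(** Changes vectors only by multiples of [e], hence [D] absorbs it. Composing with it makes [E]
    inverse to [D] on the left over [lcs 1] as well as on the right over [limg D]. *)
Let proj : 'End(g) := (\1 - daddv_pi <[e]> (lower_central g 1))%VF.
Let E : 'Hom(h, g) := (proj \o D^-1)%VF.

Let cap0 : (<[e]> :&: lower_central g 1 = 0)%VS.
Proof.
apply/eqP; rewrite -subv0; apply/subvP=> _ /memv_capP[/vlineP[a ->]].
by rewrite rpredZeq (negPf e_notin) orbF => /eqP->; rewrite scale0r mem0v.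
Qed.

Let proj_line a : proj (a *: e) = 0.
Proof.
by rewrite add_lfunE opp_lfunE id_lfunE daddv_pi_id ?subrr ?memvZ ?memv_line.
Qed.

Let projK x : x \in lower_central g 1 -> proj x = x.
Proof.
move=> x1; rewrite add_lfunE opp_lfunE id_lfunE.
have := daddv_pi_add cap0 (subvP (addvSr _ _) x x1).
rewrite (daddv_pi_id _ x1) ?[(_ :&: <[e]>)%VS]capvC // => /(canRL (addrK _))->.
by rewrite subrr subr0.
Qed.

Let D_proj x : D (proj x) = D x.
Proof.
rewrite add_lfunE opp_lfunE id_lfunE linearB /= [D (daddv_pi _ _ _)]DE.
have /vlineP[a ->] := memv_pi <[e]> (lower_central g 1) x.
by rewrite linearZ /= /ext_lie liexx Zw.1 scaler0 subr0.
Qed.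

Let E_D x : x \in lower_central g 1 -> E (D x) = x.
Proof.
move=> x1; rewrite comp_lfunE -{2}(projK x1).
have /vlineP[a /(canRL (subrK _))->]: (D^-1)%VF (D x) - x \in <[e]>%VS.
  apply: centr_e; rewrite -DE linearB /= limg_lfunVK ?subrr //.
  by rewrite memv_img ?memvf.
by rewrite linearD /= proj_line add0r.
Qed.

Let D_E u : u \in limg D -> D (E u) = u.
Proof. by move=> Du; rewrite comp_lfunE D_proj limg_lfunVK. Qed.

Let lsprod x y : g := E (ext_lie x (lie e y)).

Let lsprod_is_bilinear :
  bilinear_for (GRing.Scale.Law.clone _ _ *:%R _)
    (GRing.Scale.Law.clone _ _ *:%R _) lsprod.
Proof.
split=> u a x y; rewrite /lsprod; last by rewrite !linearP.
by rewrite ext_lieC linearP /= opprD -scalerN -!ext_lieC linearP.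
Qed.

Lemma admits_affine_structure_of_cocycle : admits_affine_structure g.
Proof.
pose m : {bilinear g -> g -> g} := HB.pack lsprod
  (bilinear_isBilinear.Build K g g g _ _ lsprod lsprod_is_bilinear).
have mC x y : m x y - m y x = lie x y.
  rewrite /= /lsprod -linearB /=.
  (* The 1-cocycle identity for [D], from the Jacobi identity in [h]. *)
  have -> : ext_lie x (lie e y) - ext_lie y (lie e x) = ext_lie e (lie x y).
    have -> : ext_lie y (lie e x) = ext_lie (lie x e) y.
      by rewrite (lieC x e) [RHS]ext_lieC linearN opprK.
    by rewrite ext_lie_jacobi opprB addrC subrK.
  by rewrite -DE E_D // memv_lcs ?memvf.
exists m; split=> // x y z.
(* [D] undoes [E] on brackets in [h]; the first component then gives
   [lie e (m v z) = lie v (lie e z)]. *)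
have mm u v : m u (m v z) = E (ext_lie u (lie v (lie e z))).
  rewrite /= /lsprod; congr (E (ext_lie u _)).
  have: D (E (ext_lie v (lie e z))) = ext_lie v (lie e z).
    exact: D_E (ext_lie_memv_limg _ _).
  by rewrite DE => /(congr1 fst).
(* Left multiplication is a representation of [g]; with [mC] this is left symmetry. *)
have key: m (lie x y) z = m x (m y z) - m y (m x z).
  by rewrite !mm -linearB -ext_lie_jacobi.
rewrite -mC linearBl in key; apply/eqP.
by rewrite subr_eq addrAC -addrA key addrC subrK.
Qed.

End AffineStructure.

(** * The choice of [e] and the conclusion *)

Theorem proposition3p4 (K : closedFieldType) (charK : [pchar K] =i pred0)
    (n : nat) (g : lieAlgType K) (dim_g : \dim {:g} = n)
    (fil_g : filiform g) (aff_g : exists c : H2 g, affine_class c) :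
  admits_affine_structure g.
Proof.
have n_gt1 := filiform_dim_gt1 fil_g.
have [n_le2|n_gt2] := leqP (\dim {:g}) 2.
  (* In dimension 2, [g] is abelian and the zero product works. *)
  have lie0 x y : lie x y = 0 :> g.
    apply/eqP; rewrite -memv0; case: fil_g => _ <- _.
    rewrite (_ : (\dim {:g} - 1)%N = 1%N); last by lia.
    by rewrite memv_lcs ?memvf.
  by exists lie; split=> [x y z|x y]; rewrite !lie0 ?subrr.
have [c affc] := aff_g.
have [w [Zw [z [x [Zz wzx]]]]] : exists w, affine_cocycle (g := g) w.
  case: c affc => P [w Zw Pw] affP; exists w; apply: affP; apply/Pw; split=> //.
  by exists (\0 : {scalar g}) => x y; rewrite subrr.
have zn := filiform_center_sub fil_g n_gt2 Zz.
pose lcs := lower_central g.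
(* For [k] in range, [v k] spans [lcs k] modulo [lcs k.+1]; [bad k] and [kerw] collect the [e] to
   avoid. *)
pose v k := vpick (lcs k :\: lcs k.+1)%VS.
pose bad k := (linfun (lie (v k)) @^-1: lcs k.+2)%VS.
pose kerw := lker (linfun (w z : g -> K^o)).
have vP k : (0 < k < \dim {:g} - 2)%N -> v k \in lcs k /\ v k \notin lcs k.+1.
  move=> lt_k; have vk: v k \in (lcs k :\: lcs k.+1)%VS by apply: memv_pick.
  split; first exact: subvP (diffvSl _ _) _ vk.
  have: v k != 0.
    have lk : lcs k != 0%VS by apply: (filiform_lcs_neq0 fil_g); lia.
    rewrite vpick0 diffv_eq0; apply: contra lk.
    by case: fil_g => nil_g _ _ le_k; apply/eqP/lcs_stable_eq0.
  apply: contra => vk1; rewrite -memv0 -(capv_diff (lcs k) (lcs k.+1)).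
  by rewrite memv_cap vk.
(* For e outside these subspaces, ad e maps each quotient of consecutive terms
   of the lower central series of the extension onto the next one. *)
have [|e eP] := @avoid_subspaces K g
    [:: lcs 1, kerw & [seq bad k | k <- iota 1 (\dim {:g} - 3)]].
  move=> U; rewrite !inE => /or3P[/eqP->|/eqP->|/mapP[k]].
  - have /subvPn[y _ y1]: ~~ (fullv <= lcs 1)%VS; last by exists y.
    apply: contraL (n_gt2) => /dimvS; have := filiform_dim_lcs1 fil_g.
    by move=> d1 /leq_trans/(_ d1); lia.
  - by exists x; rewrite memv_ker lfunE; apply/eqP.
  rewrite mem_iota => lt_k ->; have {}lt_k: (0 < k < \dim {:g} - 2)%N by lia.
  have [vk vk1] := vP k lt_k.
  have [y yP] := filiform_bracket fil_g lt_k vk vk1.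
  by exists y; rewrite -memv_preim lfunE.
have e1 : e \notin lcs 1 by apply: eP; rewrite mem_head.
have wze : w z e != 0.
  by have := eP kerw; rewrite !inE eqxx orbT memv_ker lfunE => /(_ isT).
have z_neq0 : z != 0 by apply: contraNneq wze => ->; rewrite linear0l.
apply: (admits_affine_structure_of_cocycle Zw _ e1) => [|y [ey wey]].
  by have := filiform_dim_lcs1 fil_g; lia.
have /memv_addP[_ /vlineP[a ->] [u]] : y \in (<[e]> + lcs (\dim {:g} - 2)%N)%VS.
  apply: filiform_centralizer => // k lt_k; have [vk _] := vP k lt_k.
  exists (v k) => //; have := eP (bad k).
  rewrite -memv_preim lfunE; apply; rewrite !inE map_f ?orbT // mem_iota; lia.
(* The last nonzero term is a line containing [z], so [y] is [a *: e + b *: z]; then [w e y = 0] and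
   [w z e != 0] give [b = 0]. *)
have -> : lcs (\dim {:g} - 2)%N = <[z]>%VS.
  apply/esym/eqP; rewrite eqEdim -memvE zn filiform_dim_lcs //; last by lia.
  by rewrite dim_vline z_neq0; lia.
case/vlineP=> b -> defy; move: wey.
rewrite defy linearDr !linearZr_LR /= Zw.1 mulr0 add0r (cocycle2C Zw).
move/eqP; rewrite mulf_eq0 oppr_eq0 (negPf wze) orbF => /eqP->.
by rewrite scale0r addr0 memvZ ?memv_line.
Qed.
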